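(* Let $D$ be a link diagram with a marked point $p\in D$. Regarded as a complex of $\mathbb{Z}$-modules, the unreduced $U(1)\times U(1)$-equivariant Khovanov complex $\mathit{CKh}_\alpha(D)$ splits into the direct sum of two copies of the reduced complex $\widetilde{\mathit{CKh}}_\alpha(D)$ (up to shifts of the quantum grading).
   Context: $R_\alpha=\mathbb{Z}[\alpha_1,\alpha_2]$ with $\deg\alpha_1=\deg\alpha_2=2$; $A_\alpha=R_\alpha[X]/((X-\alpha_1)(X-\alpha_2))$ with $\deg X=2$, and $X_i:=X-\alpha_i$ ($i=1,2$). $A_\alpha$ is a Frobenius $R_\alpha$-algebra with the usual multiplication $m$ and unit $\iota$, counit $\epsilon(1)=0,\ \epsilon(X)=1$, and comultiplication $\Delta(1)=1\otimes X+X\otimes 1-(\alpha_1+\alpha_2)(1\otimes 1)$, $\Delta(X)=X\otimes X-\alpha_1\alpha_2(1\otimes 1)$. For an oriented link diagram $D$ with $n$ crossings ($n_-$ of them negative), $\mathit{CKh}_\alpha(D)$ is the Khovanov complex obtained from $A_\alpha$: to each vertex $v\in\{0,1\}^n$ of the cube of resolutions, whose resolution consists of $k$ circles, one assigns $A_\alpha^{\otimes k}$ (tensor over $R_\alpha$, one factor per circle), placed in homological degree $|v|-n_-$; the differential is the sum over edges of $\pm m$ or $\pm\Delta$ applied to the factors of the merging/splitting circles, with the usual signs making squares anticommute. For $D$ with a marked point $p$, let $C_i$ ($i=1,2$) be the $R_\alpha$-subcomplex of $\mathit{CKh}_\alpha(D)$ spanned by the elements whose tensor factor on the circle containing $p$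 is $X_i$, the other factors being arbitrary. The reduced complex $\widetilde{\mathit{CKh}}_\alpha(D)$ is either one of $C_1$, $C_2$ (up to a shift of the quantum grading). *)

(* Defs.v *)
From HB Require Import structures.
From mathcomp Require Import all_boot all_order all_algebra.
From mathcomp Require Import qpoly boolp ring.
From mathcomp.multinomials Require Import mpoly.

Set Implicit Arguments.
Unset Strict Implicit.
Unset Printing Implicit Defensive.

Import Order.TTheory GRing.Theory Num.Theory.
Local Open Scope ring_scope.

Definition Ralpha := {mpoly int[2]}.

Definition alpha (i : 'I_2) : Ralpha := 'X_i.

Definition alpha1 : Ralpha := alpha ord0.
Definition alpha2 : Ralpha := alpha ord_max.

Definition Aalpha :=
  {poly %/ (('X - alpha1%:P) * ('X - alpha2%:P) : {poly Ralpha})}.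

Definition XA : Aalpha := in_qpoly _ 'X.
Definition XAi (i : 'I_2) : Aalpha := in_qpoly _ ('X - (alpha i)%:P).

(* [Aalpha] is free over [Ralpha] on 1, X. The booleans index this basis
   (false: 1, true: X), and [acoef a b] is the coordinate of [a] at [b]. *)
Definition abasis (b : bool) : Aalpha := XA ^+ b.
Definition acoef (a : Aalpha) (b : bool) : Ralpha := (a : {poly Ralpha})`_b.

Definition mul_coef (b1 b2 b : bool) : Ralpha :=
  acoef (abasis b1 * abasis b2) b.

(* [Aalpha (x) Aalpha], in coordinates over the basis of the products of 1, X *)
Definition A2 := {ffun bool * bool -> Ralpha^o}.
Definition tens2 (a a' : Aalpha) : A2 :=
  [ffun bb : bool * bool => (acoef a bb.1 * acoef a' bb.2 : Ralpha^o)].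

Definition comul (b : bool) : A2 :=
  if b then tens2 XA XA - (alpha1 * alpha2) *: tens2 1 1
  else tens2 1 XA + tens2 XA 1 - (alpha1 + alpha2) *: tens2 1 1.

Definition comul_coef (b b1 b2 : bool) : Ralpha := comul b (b1, b2).

Local Notation fA := (('X - alpha1%:P) * ('X - alpha2%:P) : {poly Ralpha}).

Section QuadraticQuotient.
Variables (R : idomainType) (a b : R).
Let f := ('X - a%:P) * ('X - b%:P).

Lemma size_quadratic : size f = 3%N.
Proof. by rewrite size_mul ?polyXsubC_eq0 ?size_XsubC. Qed.

Lemma mk_monic_quadratic : mk_monic f = f.
Proof. by rewrite /mk_monic size_quadratic monicMl ?monicXsubC. Qed.

Lemma coef_in_quadratic (q : {poly R}) i : (size q <= 2)%N ->
  (in_qpoly f q : {poly R})`_i = q`_i.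
Proof.
by move=> sq; rewrite in_qpoly_small // mk_monic_quadratic size_quadratic.
Qed.

Lemma coef_in_quadratic_sqr i :
  (in_qpoly f 'X^2 : {poly R})`_i = ((a + b)%:P * 'X - (a * b)%:P)`_i.
Proof.
pose g : {poly R} := (a + b)%:P * 'X - (a * b)%:P.
have -> : 'X^2 = f + g by rewrite /f /g !rmorphD !rmorphM /=; ring.
have h0 : in_qpoly f f = 0.
  apply: val_inj; rewrite /= mk_monic_quadratic.
  by rewrite Pdiv.RingMonic.rmodpp // monicMl ?monicXsubC.
have -> : in_qpoly f (f + g) = in_qpoly f g.
  by rewrite (rmorphD (in_qpoly f)) -[RHS]add0r; congr (_ + _).
rewrite coef_in_quadratic // /g.
rewrite (leq_trans (size_polyD _ _)) // geq_max size_polyN.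
rewrite (leq_trans (size_polyC_leq1 _)) // andbT.
rewrite (leq_trans (size_polyMleq _ _)) // size_polyX addn2 /= ltnS.
exact: size_polyC_leq1.
Qed.
End QuadraticQuotient.

Lemma abasisE b : abasis b = in_qpoly fA 'X^b.
Proof. by rewrite /abasis /XA -rmorphXn. Qed.

Lemma acoef_abasis b b' : acoef (abasis b) b' = (b' == b)%:R.
Proof.
rewrite abasisE /acoef coef_in_quadratic ?size_polyXn; last by case: b.
by rewrite coefXn; case: b b' => [] [].
Qed.

Lemma acoef_XAi i b : acoef (XAi i) b = if b then 1 else - alpha i.
Proof.
rewrite /acoef coef_in_quadratic ?size_XsubC // coefB coefX coefC.
by case: b; rewrite /= ?subr0 ?sub0r.
Qed.

Lemma mul_coefE b1 b2 b :
  mul_coef b1 b2 b =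
  if b1 && b2 then (if b then alpha1 + alpha2 else - (alpha1 * alpha2))
  else (b == b1 || b2)%:R.
Proof.
rewrite /mul_coef !abasisE -rmorphM /= -exprD /acoef.
case: ifP => [/andP[-> ->]|nb12]; last first.
  rewrite coef_in_quadratic ?size_polyXn ?coefXn; last by case: b1 b2 nb12 => [] [].
  by case: b1 b2 b nb12 => [] [] [].
rewrite coef_in_quadratic_sqr coefB coefCM coefX coefC.
by case: b; rewrite /= ?mulr1 ?mulr0 ?subr0 ?sub0r.
Qed.

Lemma comul_coefE b b1 b2 :
  comul_coef b b1 b2 =
  if b then (if b1 && b2 then 1
             else if b1 || b2 then 0 else - (alpha1 * alpha2))
  else (if b1 && b2 then 0
        else if b1 || b2 then 1 else - (alpha1 + alpha2)).
Proof.
have -> : comul_coef b b1 b2 =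
  if b then acoef (abasis true) b1 * acoef (abasis true) b2
     - (alpha1 * alpha2) * (acoef (abasis false) b1 * acoef (abasis false) b2)
  else acoef (abasis false) b1 * acoef (abasis true) b2
     + acoef (abasis true) b1 * acoef (abasis false) b2
     - (alpha1 + alpha2) * (acoef (abasis false) b1 * acoef (abasis false) b2).
  by case: b; rewrite /comul_coef !ffunE.
rewrite !acoef_abasis; case: b b1 b2 => [] [] [] /=;
rewrite ?(mulr0, mul0r, mulr1, subr0, add0r, addr0, oppr0, sub0r) //.
Qed.

Lemma alpha_root i : alpha i ^+ 2 = (alpha1 + alpha2) * alpha i - alpha1 * alpha2.
Proof.
have [->|->] : i = ord0 \/ i = ord_max.
  by case: i => [[|[|//]] ?]; [left|right]; apply: val_inj.
all: rewrite -/alpha1 -/alpha2; ring.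
Qed.

Lemma mul_reduced i b b' :
  mul_coef true b b' - alpha i * mul_coef false b b' =
  (if b' then 1 else - alpha i) *
  (mul_coef true b true - alpha i * mul_coef false b true).
Proof.
have r : alpha i * alpha i = (alpha1 + alpha2) * alpha i - alpha1 * alpha2.
  by rewrite -alpha_root.
rewrite !mul_coefE.
case: b b' => [] [] /=; rewrite ?(mulr0,mulr1,mul1r,subr0,sub0r) //.
by rewrite mulrBr !mulNr opprK r; ring.
Qed.

Lemma comul_reduced i b b' :
  comul_coef true b b' - alpha i * comul_coef false b b' =
  (if b then 1 else - alpha i) *
  (comul_coef true true b' - alpha i * comul_coef false true b').
Proof.
have r : alpha i * alpha i = (alpha1 + alpha2) * alpha i - alpha1 * alpha2.
  by rewrite -alpha_root.
rewrite !comul_coefE.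
case: b b' => [] [] /=; rewrite ?(mulr0,mulr1,mul1r,subr0,sub0r) //.
by rewrite mulrN opprK mulrN mulNr opprK r; ring.
Qed.

Lemma mul_coefC b1 b2 b : mul_coef b1 b2 b = mul_coef b2 b1 b.
Proof. by rewrite !mul_coefE andbC orbC. Qed.

Lemma comul_coefC b b1 b2 : comul_coef b b1 b2 = comul_coef b b2 b1.
Proof. by rewrite !comul_coefE andbC orbC. Qed.

(* A diagram is given by its planar-diagram code. The four ends of a crossing
   are numbered counterclockwise by 'Z_4, end 0 being the incoming end of the
   lower strand: the lower strand runs from 0 to 2, the upper one from 3 to 1
   at a positive crossing and from 1 to 3 at a negative one. *)
Definition dart (n : nat) : finType := ('I_n * 'Z_4)%type.

Definition outgoing n (pos : 'I_n -> bool) (d : dart n) : bool :=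
  [|| d.2 == 2%:R, (d.2 == 1) && pos d.1 | (d.2 == 3%:R) && ~~ pos d.1].

Definition rot_dart n (d : dart n) : dart n := (d.1, d.2 + 1).

(* Euler's formula V - E + F = 2C for the underlying 4-valent graph, which has
   n vertices and 2n edges: every connected component has genus 0. *)
Definition planar_glue n (glue : dart n -> dart n) : Prop :=
  (n + fcard (fun d => rot_dart (glue d)) predT =
   2 * n + 2 * n_comp [rel d d' | (d' == rot_dart d) || (d' == glue d)] predT)%N.

(* [glue] matches the two ends of each edge; components without crossings are
   only counted, by [nloops]. *)
Record link_diagram := LinkDiagram {
  ncross : nat;
  nloops : nat;
  positive : 'I_ncross -> bool;
  glue : dart ncross -> dart ncross;
  glueK : involutive glue;
  glue_oriented :
    forall d, outgoing positive (glue d) = ~~ outgoing positive d;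
  glue_planar : planar_glue glue
}.

(* A point of the diagram off the crossings, up to moving it along the strand
   between two consecutive crossings: an end at a crossing stands for the edge
   it belongs to. *)
Definition point (D : link_diagram) : finType :=
  (dart (ncross D) + 'I_(nloops D))%type.

Section Cube.
Variable D : link_diagram.

Definition vertex : finType := {ffun 'I_(ncross D) -> bool}.

Definition end_of (c : 'I_(ncross D)) (i : 'Z_4) : point D := inl (c, i).

(* The 0-smoothing joins the ends 0, 1 and the ends 2, 3; the 1-smoothing joins
   0, 3 and 1, 2. The former is the oriented one at a positive crossing. *)
Definition smooth (v : vertex) (d : dart (ncross D)) : dart (ncross D) :=
  (d.1, if v d.1 then - 1 - d.2 else 1 - d.2).

Definition adjacent (v : vertex) : rel (point D) := fun p q =>
  match p, q with
  | inl d, inl d' => (d' == glue d) || (d' == smooth v d)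
  | _, _ => false
  end.

Definition circ (v : vertex) (p : point D) : {set point D} :=
  [set q | connect (adjacent v) p q].

Definition circles (v : vertex) : {set {set point D}} :=
  [set circ v p | p : point D].

Definition circle (v : vertex) : finType := {c : {set point D} | c \in circles v}.

Lemma circ_in v p : circ v p \in circles v.
Proof. exact: imset_f. Qed.

Definition circle_at (v : vertex) (p : point D) : circle v :=
  exist _ (circ v p) (circ_in v p).

(* A vertex together with a label 1 or X on each circle: a basis element of
   the tensor power [Aalpha^(x)k] sitting at this vertex. *)
Definition state : finType := {v : vertex & {ffun circle v -> bool}}.

Definition lab (s : state) (p : point D) : bool :=
  tagged s (circle_at (tag s) p).

Definition weight (v : vertex) : nat := #|[pred c | v c]|.
Definition nneg : nat := #|[pred c | ~~ positive (l := D) c]|.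
Definition npos : nat := #|[pred c | positive (l := D) c]|.

Definition hdeg (s : state) : int := (weight (tag s))%:Z - nneg%:Z.

(* With deg X = 2 positive, m and Delta have degrees 0 and 2. The shift
   by -#circles - |v| makes the differential homogeneous of degree 0; the
   constant makes the grading the opposite of Khovanov's original one. *)
Definition qdeg (s : state) : int :=
  2 * #|[pred c | tagged s c]|%:Z - #|circle (tag s)|%:Z
  - (weight (tag s))%:Z - npos%:Z + 2 * nneg%:Z.

Definition edge (v w : vertex) (c : 'I_(ncross D)) : bool :=
  ~~ v c && (w == [ffun c' => (c' == c) || v c']).

Definition edge_sign (v : vertex) (c : 'I_(ncross D)) : Ralpha :=
  (-1) ^+ #|[pred c' : 'I_(ncross D) | (c' < c)%N && v c']|.

Definition same_off (C : {set point D}) (s t : state) : bool :=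
  [forall p, (p \notin C) ==> (lab s p == lab t p)].

(* The matrix coefficient from s to t of the (unsigned) map m or Delta along
   the edge at c. In either smoothing of c, each of the two arcs contains
   exactly one of the ends 0 and 2. Circles away from c are equal as sets of
   points in the two resolutions. The last case does not occur, since D is
   planar. *)
Definition edge_coef (c : 'I_(ncross D)) (s t : state) : Ralpha :=
  let a := end_of c 0 in
  let a' := end_of c 2%:R in
  let v := tag s in
  let w := tag t in
  if (circ v a != circ v a') && (circ w a == circ w a') then
    (if same_off (circ w a) s t
     then mul_coef (lab s a) (lab s a') (lab t a) else 0)
  else if (circ v a == circ v a') && (circ w a != circ w a') then
    (if same_off (circ v a) s t
     then comul_coef (lab s a) (lab t a) (lab t a') else 0)
  else 0.

Definition diff_coef (s t : state) : Ralpha :=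
  \sum_(c | edge (tag s) (tag t) c) edge_sign (tag s) c * edge_coef c s t.

Definition gen (k : int) : finType := {s : state | hdeg s == k}.

(* The sum over the vertices of weight k + n_- of the tensor powers of
   [Aalpha], which are free on the labellings of the circles by 1, X. *)
Definition chain (k : int) := {ffun gen k -> Ralpha^o}.

Definition diff k (x : chain k) : chain (k + 1) :=
  [ffun t : gen (k + 1) => \sum_(s : gen k) diff_coef (val s) (val t) *: x s].

Lemma diff_is_additive k : {morph @diff k : x y / x - y}.
Proof.
move=> x y; apply/ffunP=> t; rewrite !ffunE -sumrB.
by apply: eq_bigr => s _; rewrite !ffunE scalerBr.
Qed.

HB.instance Definition _ k :=
  GRing.isZmodMorphism.Build (chain k) (chain (k + 1)) (@diff k)
    (@diff_is_additive k).

Definition chain_homog k (j : int) (x : chain k) : Prop :=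
  forall (s : gen k) (m : 'X_{1..2}), m \in msupp (x s : Ralpha) ->
    2 * (mdeg m)%:Z + qdeg (val s) = j.

(* The pure tensor at v with factor [a C] on each circle C of the resolution
   at v; the values of [a] on other sets are irrelevant. *)
Definition pure k (v : vertex) (a : {set point D} -> Aalpha) : chain k :=
  [ffun s : gen k =>
    if tag (val s) == v
    then \prod_(C : circle (tag (val s)))
           acoef (a (val C)) (tagged (val s) C) : Ralpha^o
    else 0].

Section Reduced.
Variables (p : point D) (i : 'I_2).

Definition Rspan (V : lmodType Ralpha) (P : V -> Prop) (x : V) : Prop :=
  exists r : seq (Ralpha * V),
    (forall e, e \in r -> P e.2) /\ x = \sum_(e <- r) e.1 *: e.2.

Definition marked_pure k (x : chain k) : Prop :=
  exists (v : vertex) (a : {set point D} -> Aalpha),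
    a (circ v p) = XAi i /\ x = pure k v a.

Definition in_reduced k : {pred chain k} :=
  fun x => `[< Rspan (@marked_pure k) x >].

Lemma in_reduced_zmod k : zmod_closed (@in_reduced k).
Proof.
split=> [|x y]; first by apply/asboolP; exists [::]; rewrite big_nil.
move=> /asboolP[r [Pr ->]] /asboolP[r' [Pr' ->]]; apply/asboolP.
exists (r ++ [seq (- e.1, e.2) | e <- r']); split=> [e|].
  rewrite mem_cat => /orP[/Pr //|/mapP[e' /Pr' Pe' ->]]; exact: Pe'.
rewrite big_cat big_map /= -sumrN; congr (_ + _).
by apply: eq_bigr => e _; rewrite scaleNr.
Qed.

Lemma adjacent_sym v : ssrbool.symmetric (adjacent v).
Proof.
have smoothK : involutive (smooth v).
  by case=> c e; rewrite /smooth /=; congr pair; case: (v c); ring.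
move=> [d|q] [d'|q'] //=; congr (_ || _); apply/eqP/eqP=> ->.
- by rewrite glueK. - by rewrite glueK.
- by rewrite smoothK. - by rewrite smoothK.
Qed.

Lemma connectC v : connect_sym (adjacent v).
Proof. exact/sym_connect_sym/adjacent_sym. Qed.

Lemma circ_eq v q r : (circ v q == circ v r) = (r \in circ v q).
Proof.
apply/eqP/idP=> [->|]; first by rewrite inE connect0.
rewrite inE => qr; apply/setP=> t; rewrite !inE.
exact: (same_connect (@connectC v)).
Qed.

Lemma mem_circ v q : q \in circ v q.
Proof. by rewrite inE connect0. Qed.

Lemma mem_circC v q r : (q \in circ v r) = (r \in circ v q).
Proof. by rewrite !inE connectC. Qed.

Section Edge.
Variables (v w : vertex) (c : 'I_(ncross D)).
Hypothesis vw : edge v w c.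
Let a := end_of c 0.
Let a' := end_of c 2%:R.

Lemma edge_val c' : w c' = (c' == c) || v c'.
Proof. by case/andP: vw => _ /eqP->; rewrite ffunE. Qed.

Lemma ends_v e : end_of c e \in circ v a :|: circ v a'.
Proof.
have vc : v c = false by case/andP: vw => /negbTE.
have adj e' : end_of c (1 - e') \in circ v (end_of c e').
  by rewrite inE connect1 //= /smooth /= vc eqxx orbT.
have h : [|| e == 0, e == 1 - 0, e == 2%:R | e == 1 - 2%:R].
  by case: e => [[|[|[|[|]]]]].
rewrite inE; case/or4P: h => /eqP->; rewrite ?adj ?orbT // ?mem_circ ?orbT //.
Qed.

Lemma ends_w e : end_of c e \in circ w a :|: circ w a'.
Proof.
have wc : w c by rewrite edge_val eqxx.
have adj e' : end_of c (- 1 - e') \in circ w (end_of c e').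
  by rewrite inE connect1 //= /smooth /= wc eqxx orbT.
have h : [|| e == 0, e == - 1 - 0, e == 2%:R | e == - 1 - 2%:R].
  by case: e => [[|[|[|[|]]]]].
rewrite inE; case/or4P: h => /eqP->; rewrite ?adj ?orbT // ?mem_circ ?orbT //.
Qed.

Lemma adjacent_off (q r : point D) :
  (forall e, q != end_of c e) -> adjacent v q r = adjacent w q r.
Proof.
case: q => [[c' e']|q] //= qc; case: r => // d'; rewrite /smooth /= edge_val.
by case: (c' =P c) => [ec|_ //]; case/eqP: (qc e'); rewrite ec.
Qed.

Lemma closed_circU u q r :
  closed (adjacent u) [pred t | t \in circ u q :|: circ u r].
Proof.
apply: (intro_closed (@connectC u)) => x y xy /=; rewrite !inE.
by case/orP=> /connect_trans -> //; rewrite ?orbT // connect1.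
Qed.

Lemma closedU_w : closed (adjacent w) [pred t | t \in circ v a :|: circ v a'].
Proof.
apply: (intro_closed (@connectC w)) => x y xy xU.
case: (pickP (fun e => x == end_of c e)) => [e /eqP ex|xc].
  move: xy; rewrite ex; case: y => // -[c' e'] /= /orP[] /eqP yE.
    have := @closed_circU v a a' x (inl (c', e')); rewrite /= xU => <- //.
    by rewrite ex /= yE eqxx.
  by move: yE; rewrite /smooth /= => -[-> _]; exact: ends_v.
rewrite -(@closed_circU v a a' x) //= adjacent_off // => e.
by rewrite xc.
Qed.

Lemma closedU_v : closed (adjacent v) [pred t | t \in circ w a :|: circ w a'].
Proof.
apply: (intro_closed (@connectC v)) => x y xy xU.
case: (pickP (fun e => x == end_of c e)) => [e /eqP ex|xc].
  move: xy; rewrite ex; case: y => // -[c' e'] /= /orP[] /eqP yE.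
    have := @closed_circU w a a' x (inl (c', e')); rewrite /= xU => <- //.
    by rewrite ex /= yE eqxx.
  by move: yE; rewrite /smooth /= => -[-> _]; exact: ends_w.
rewrite -(@closed_circU w a a' x) //= -adjacent_off // => e.
by rewrite xc.
Qed.

Lemma circU : circ v a :|: circ v a' = circ w a :|: circ w a'.
Proof.
apply/eqP; rewrite eqEsubset; apply/andP; split; apply/subsetP=> x.
  rewrite inE => /orP[]; rewrite inE => /(closed_connect closedU_v) /= <-;
  exact: ends_w.
rewrite inE => /orP[]; rewrite inE => /(closed_connect closedU_w) /= <-;
exact: ends_v.
Qed.

Lemma circ_off q : q \notin circ v a :|: circ v a' -> circ v q = circ w q.
Proof.
have sub u u' (U := circ v a :|: circ v a') :
    {in [predC U], forall x y, adjacent u x y -> adjacent u' x y} ->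
    closed (adjacent u) (mem U) -> q \notin U -> circ u q \subset circ u' q.
  move=> uu' clU qU; apply/subsetP=> x; rewrite !inE => /connectP[s].
  elim: s q qU => [|y s IH] t tU /=; first by move=> _ ->; rewrite connect0.
  case/andP=> ty ys xs; apply: (connect_trans (connect1 (uu' _ _ _ ty))) => //.
  by apply: IH => //; rewrite -(clU _ _ ty).
have off x : x \in [predC circ v a :|: circ v a'] -> forall e, x != end_of c e.
  by rewrite inE => xU e; apply: contraNneq xU => ->; exact: ends_v.
move=> qU; apply/eqP; rewrite eqEsubset !sub //.
- by move=> x xU y; rewrite (adjacent_off _ (off _ xU)).
- exact: closedU_w.
- by move=> x xU y; rewrite (adjacent_off _ (off _ xU)).
- exact: closed_circU.
Qed.
End Edge.

(* An element lies in the reduced complex iff its coordinates at states that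
   differ only by the label at [p] are in the proportion of those of X_i. *)

Definition set_label (s : state) (b : bool) : state :=
  existT (fun v => {ffun circle v -> bool}) (tag s)
    [ffun C => if C == circle_at (tag s) p then b else tagged s C].

Definition gset_label k (s : gen k) (b : bool) : gen k :=
  exist (fun s => hdeg s == k) (set_label (val s) b) (valP s).

Lemma lab_set_label s b q :
  lab (set_label s b) q = if q \in circ (tag s) p then b else lab s q.
Proof.
rewrite /lab /set_label /= ffunE -val_eqE /= circ_eq -mem_circC.
by [].
Qed.

Lemma circle_atP v (C : circle v) : exists q, C = circle_at v q.
Proof. by case: C => C Cv; have /imsetP[q _ E] := Cv; exists q; apply: val_inj. Qed.

Lemma lab_circ s q q' : circ (tag s) q = circ (tag s) q' -> lab s q = lab s q'.
Proof. by move=> E; rewrite /lab; congr (tagged s _); exact: val_inj. Qed.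

Lemma set_label_id s : set_label s (lab s p) = s.
Proof.
case: s => v f; congr existT; apply/ffunP=> C; rewrite ffunE.
by case: eqP => // ->.
Qed.

Lemma set_label_set s b b' : set_label (set_label s b) b' = set_label s b'.
Proof.
rewrite /set_label /=; congr existT.
by apply/ffunP=> C; rewrite !ffunE; case: (C == _).
Qed.

Lemma gset_labelK k (s : gen k) b b' :
  lab (val s) p = b -> gset_label (gset_label s b') b = s.
Proof.
by move=> <-; apply: val_inj; rewrite /= set_label_set set_label_id.
Qed.

Lemma lab_gset_label k (s : gen k) b : lab (val (gset_label s b)) p = b.
Proof. by rewrite lab_set_label mem_circ. Qed.

Lemma state_lab_inj (s t : state) :
  tag s = tag t -> lab s =1 lab t -> s = t.
Proof.
case: s t => v f [w g] /= vw; case: w / vw g => g fg.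
by congr existT; apply/ffunP=> C; have [q ->] := circle_atP C; exact: (fg q).
Qed.

Lemma edge_coef_reduced c s t b' : edge (tag s) (tag t) c ->
  let E b b' := edge_coef c (set_label s b) (set_label t b') in
  E true b' - alpha i * E false b' =
  (if b' then 1 else - alpha i) * (E true true - alpha i * E false true).
Proof.
move=> st; set v := tag s in st *; set w := tag t in st *.
set a := end_of c 0; set a' := end_of c 2%:R.
have UE : circ v a :|: circ v a' = circ w a :|: circ w a' := circU st.
have aP u q r : (q \in circ u r) = (circ u q == circ u r).
  by rewrite eq_sym circ_eq.
have off_in C : C = circ v a :|: circ v a' -> p \in C -> forall b b',
    same_off C (set_label s b) (set_label t b') = same_off C s t.
  move=> -> pU b b''; apply: eq_forallb => q.
  case: (boolP (q \in _)) => //= qU; rewrite !lab_set_label -/v -/w.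
  suff [-> ->] : (q \in circ v p) = false /\ (q \in circ w p) = false by [].
  split; apply: contraNF qU; rewrite aP => /eqP.
    by move: pU; rewrite !in_setU !aP => + ->.
  by move: pU; rewrite UE !in_setU !aP => + ->.
have off_out C : C = circ v a :|: circ v a' -> p \notin C ->
    exists S, forall b b',
    same_off C (set_label s b) (set_label t b') = (b == b') && S.
  move=> EC pU; exists (same_off C (set_label s true) (set_label t true)) => b b''.
  have vwp : circ v p = circ w p.
    by apply: (circ_off st); rewrite -EC.
  apply/idP/idP => [/forallP H|/andP[/eqP<- /forallP H]].
    apply/andP; split.
      have := H p; rewrite pU /= !lab_set_label -/v -/w !mem_circ; exact.
    apply/forallP=> q; have := H q; rewrite !lab_set_label -/v -/w -vwp.
    by case: (q \in circ v p); rewrite ?eqxx ?implybT.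
  apply/forallP=> q; have := H q; rewrite !lab_set_label -/v -/w -vwp.
  by case: (q \in circ v p); rewrite ?eqxx ?implybT.
have fin (S : bool) (K : Ralpha) : 
    (if (true == b') && S then K else 0) -
    alpha i * (if (false == b') && S then K else 0) =
    (if b' then 1 else - alpha i) *
    ((if (true == true) && S then K else 0) -
     alpha i * (if (false == true) && S then K else 0)).
  by case: b' S => [] []; rewrite /= ?mulr0 ?subr0 ?mul1r ?sub0r ?mulNr ?mulr0 ?oppr0.
rewrite /edge_coef /= -/a -/a' -/v -/w.
case: ifP => [/andP[ne /eqP we]|_].
  have CE : circ w a = circ v a :|: circ v a' by rewrite UE -we setUid.
  have [pC|pC] := boolP (p \in circ w a).
    rewrite !(off_in _ CE pC); case: ifP => _; last by rewrite !mulr0 subr0 mulr0.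
    rewrite !lab_set_label -/v -/w (mem_circC w a p) pC.
    move: pC; rewrite CE in_setU => /orP[]; rewrite mem_circC => pa.
      have -> : (a' \in circ v p) = false.
        by apply: contraNF ne => pa'; move: pa pa'; rewrite !aP => /eqP-> /eqP->.
      by rewrite pa mul_reduced.
    have -> : (a \in circ v p) = false.
      by apply: contraNF ne => pa'; move: pa pa'; rewrite !aP => /eqP-> /eqP->.
    by rewrite pa; move: (lab s a) => l; rewrite !(mul_coefC l) mul_reduced.
  have [S SE] := off_out _ CE pC; rewrite !SE !lab_set_label -/v -/w.
  have -> : (a \in circ w p) = false by rewrite mem_circC; exact: negbTE.
  move: (pC); rewrite CE in_setU negb_or (mem_circC v p a) (mem_circC v p a').
  move=> /andP[/negbTE-> /negbTE->].
  exact: fin.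
case: ifP => [/andP[/eqP ve ne]|_]; last by rewrite !mulr0 subr0 mulr0.
have CE : circ v a = circ v a :|: circ v a' by rewrite -ve setUid.
have [pC|pC] := boolP (p \in circ v a).
  rewrite !(off_in _ CE pC); case: ifP => _; last by rewrite !mulr0 subr0 mulr0.
  rewrite !lab_set_label -/v -/w (mem_circC v a p) pC.
  move: pC; rewrite CE UE in_setU => /orP[]; rewrite mem_circC => pa.
    have -> : (a' \in circ w p) = false.
      by apply: contraNF ne => pa'; move: pa pa'; rewrite !aP => /eqP-> /eqP->.
    by rewrite pa comul_reduced.
  have -> : (a \in circ w p) = false.
    by apply: contraNF ne => pa'; move: pa pa'; rewrite !aP => /eqP-> /eqP->.
  by rewrite pa; move: (lab t a) => l; rewrite !(comul_coefC _ l) comul_reduced.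
have [S SE] := off_out _ CE pC; rewrite !SE !lab_set_label -/v -/w.
have -> : (a \in circ v p) = false by rewrite mem_circC; exact: negbTE.
move: (pC); rewrite CE UE in_setU negb_or (mem_circC w p a) (mem_circC w p a').
move=> /andP[/negbTE-> /negbTE->].
exact: fin.
Qed.

Lemma diff_coef_reduced s t b' :
  let E b b' := diff_coef (set_label s b) (set_label t b') in
  E true b' - alpha i * E false b' =
  (if b' then 1 else - alpha i) * (E true true - alpha i * E false true).
Proof.
rewrite /= /diff_coef /= !mulr_sumr -!sumrB mulr_sumr; apply: eq_bigr => c st.
have lin (e x y z u q r : Ralpha) : x - q * y = r * (z - q * u) ->
    e * x - q * (e * y) = r * (e * z - q * (e * u)).
  by move=> h; transitivity (e * (x - q * y)); [ring | rewrite h; ring].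
exact/lin/(@edge_coef_reduced c s t b' st).
Qed.

Definition proportional k (x : chain k) : Prop :=
  forall s, x s = (if lab (val s) p then 1 else - alpha i) * x (gset_label s true).

Lemma diff_proportional k (x : chain k) : proportional x -> proportional (diff x).
Proof.
move=> Px.
have E t b : diff x (gset_label t b) =
   \sum_(s : gen k | lab (val s) p)
     (diff_coef (set_label (val s) true) (set_label (val t) b) -
      alpha i * diff_coef (set_label (val s) false) (set_label (val t) b)) * x s.
  rewrite ffunE (bigID (fun s : gen k => lab (val s) p)) /=.
  rewrite [X in _ + X](reindex_onto (fun s => gset_label s false)
    (fun s => gset_label s true)) /=; last first.
    by move=> s /negbTE; exact: gset_labelK.
  rewrite [X in _ + X](eq_bigl (fun s : gen k => lab (val s) p)); last first.
    move=> s; rewrite lab_gset_label /=; apply/eqP/idP=> [<-|].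
      by rewrite lab_gset_label.
    exact: gset_labelK.
  rewrite -big_split /=; apply: eq_bigr => s ls.
  rewrite [x (gset_label s false)]Px lab_gset_label gset_labelK //.
  have -> : set_label (val s) true = val s by rewrite -ls set_label_id.
  rewrite mulrBl /GRing.scale /=; congr (_ + _).
  by rewrite mulNr mulrN mulrCA mulrA.
move=> t; have tE : t = gset_label t (lab (val t) p).
  by apply: val_inj; rewrite /= set_label_id.
rewrite {1}tE !E mulr_sumr; apply: eq_bigr => s _.
by rewrite diff_coef_reduced mulrA.
Qed.

Lemma pure_proportional k v a :
  a (circ v p) = XAi i -> proportional (pure k v a).
Proof.
move=> av s; rewrite /pure !ffunE /=; case: eqP => [sv|_]; last by rewrite mulr0.
rewrite (bigD1 (circle_at (tag (val s)) p)) //=.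
rewrite [X in _ = _ * X](bigD1 (circle_at (tag (val s)) p)) //=.
rewrite ffunE eqxx [in circ _ p]sv av !acoef_XAi mul1r; congr (_ * _).
by apply: eq_bigr => C /negbTE Cp; rewrite ffunE Cp.
Qed.

Lemma in_reduced_proportional k (x : chain k) :
  x \in @in_reduced k -> proportional x.
Proof.
move=> /asboolP[r [Pr ->]] s; rewrite !sum_ffunE mulr_sumr big_seq [RHS]big_seq.
apply: eq_bigr => e /Pr[v [a [av ->]]]; rewrite !ffunE.
have := @pure_proportional k _ _ av s; rewrite /pure !ffunE /GRing.scale /= => ->.
by rewrite mulrCA.
Qed.

Definition marked_factor (s : state) (C : {set point D}) : Aalpha :=
  if C == circ (tag s) p then XAi i
  else if insub C is Some c then abasis (tagged s c) else 1.

Lemma pure_marked_factor k (s t : gen k) : lab (val s) p ->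
  pure k (tag (val s)) (marked_factor (val s)) t =
  if s == gset_label t true then (if lab (val t) p then 1 else - alpha i) else 0.
Proof.
move=> sp; rewrite /pure ffunE; case: eqP => [ts|ts]; last first.
  by case: eqP => // st; case: ts; rewrite st.
case: s t ts sp => [[v f] vk] [[w g] wk] /= ts; case: v / ts f vk => f vk sp.
set s := exist _ (existT _ w f) vk; set t := exist _ (existT _ w g) wk.
have fE q : lab (val s) q = f (circle_at w q) by [].
have gE q : lab (val t) q = g (circle_at w q) by [].
have eC q : circ w q != circ w p ->
  acoef (marked_factor (val s) (circ w q)) (g (circle_at w q)) =
  (lab (val t) q == lab (val s) q)%:R.
  rewrite /marked_factor => /negbTE->.
  by rewrite (insubT (fun C => C \in circles w) (circ_in w q)) acoef_abasis.
rewrite (bigD1 (circle_at w p)) //= {1}/marked_factor eqxx acoef_XAi -gE.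
case: eqP => [st|st].
  rewrite big1 ?mulr1 // => C Cp; have [q Cq] := circle_atP C; subst C.
  rewrite -val_eqE /= in Cp; rewrite eC // [in lab (val s)]st lab_set_label ifF ?eqxx //.
  by rewrite -circ_eq eq_sym; apply/negbTE.
have [q qp nq] : exists2 q, circ w q != circ w p & lab (val t) q != lab (val s) q.
  apply: contrapT => nex; apply: st; apply/val_inj/state_lab_inj => //= q.
  rewrite lab_set_label; case: ifP => qp.
    by rewrite -[RHS]sp; apply/lab_circ/esym/eqP; rewrite circ_eq.
  apply/eqP; apply: contrapT => /negP nq; apply: nex; exists q.
    by rewrite eq_sym circ_eq qp.
  by rewrite eq_sym.
rewrite (bigD1 (circle_at w q)) /=; last by rewrite -val_eqE.
by rewrite eC // (negbTE nq) mul0r mulr0.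
Qed.

Lemma scale_chain k (r : Ralpha) (y : chain k) s : (r *: y) s = r * y s.
Proof. by rewrite ffunE. Qed.

Lemma proportional_in_reduced k (x : chain k) :
  proportional x -> x \in @in_reduced k.
Proof.
move=> Px; apply/asboolP.
exists [seq (x s : Ralpha, pure k (tag (val s)) (marked_factor (val s))) |
  s <- enum [pred s : gen k | lab (val s) p]]; split.
  move=> e /mapP[s _ ->] /=; exists (tag (val s)), (marked_factor (val s)).
  by rewrite /marked_factor eqxx.
rewrite big_map /=; apply/ffunP=> t; rewrite sum_ffunE big_enum /=.
rewrite (bigD1 (gset_label t true)) /=; last by rewrite inE lab_gset_label.
rewrite scale_chain (pure_marked_factor t (lab_gset_label t true)) eqxx big1 ?addr0.
  by rewrite {1}Px mulrC.
move=> s /andP[sp st]; rewrite scale_chain (pure_marked_factor t sp).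
by rewrite (negbTE st) mulr0.
Qed.

Lemma diff_in_reduced k (x : chain k) :
  x \in @in_reduced k -> diff x \in @in_reduced (k + 1).
Proof.
move/in_reduced_proportional => Px.
exact/proportional_in_reduced/diff_proportional.
Qed.

HB.instance Definition _ k :=
  GRing.isZmodClosed.Build (chain k) (@in_reduced k) (@in_reduced_zmod k).

Record rchain (k : int) := RChain {
  rchain_val :> chain k;
  _ : rchain_val \in @in_reduced k
}.

HB.instance Definition _ k := [isSub for @rchain_val k].
HB.instance Definition _ k := [Choice of rchain k by <:].
HB.instance Definition _ k := [SubChoice_isSubZmodule of rchain k by <:].

Definition rdiff k (x : rchain k) : rchain (k + 1) :=
  RChain (diff_in_reduced (valP x)).

Lemma rdiff_is_additive k : {morph @rdiff k : x y / x - y}.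
Proof. by move=> x y; apply: val_inj; rewrite /= !raddfB. Qed.

HB.instance Definition _ k :=
  GRing.isZmodMorphism.Build (rchain k) (rchain (k + 1)) (@rdiff k)
    (@rdiff_is_additive k).

End Reduced.
End Cube.

(* A cochain complex of abelian groups with a second (quantum) grading, given
   by its homogeneous elements. The identity d o d = 0 is not recorded: it
   plays no role in the notion of isomorphism. *)
Record gcomplex := GComplex {
  gob :> int -> zmodType;
  gdiff : forall k, {additive gob k -> gob (k + 1)};
  ghomog : forall k, int -> gob k -> Prop
}.

(* The quantum degree is raised by a. *)
Definition gshift (a : int) (C : gcomplex) : gcomplex :=
  {| gob := gob C; gdiff := @gdiff C;
     ghomog := fun k j x => @ghomog C k (j - a) x |}.

Section DirectSum.
Variables C C' : gcomplex.

Definition sum_diff k (x : (C k * C' k)%type) : (C (k + 1)%R * C' (k + 1)%R)%type :=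
  (gdiff C k x.1, gdiff C' k x.2).

Lemma sum_diff_is_additive k : {morph @sum_diff k : x y / x - y}.
Proof. by move=> x y; rewrite /sum_diff /= !raddfB. Qed.

HB.instance Definition _ k :=
  GRing.isZmodMorphism.Build (C k * C' k)%type (C (k + 1)%R * C' (k + 1)%R)%type
    (@sum_diff k) (@sum_diff_is_additive k).

Definition gsum : gcomplex :=
  {| gob := fun k => (C k * C' k)%type;
     gdiff := fun k => @sum_diff k;
     ghomog := fun k j x => ghomog j x.1 /\ ghomog j x.2 |}.
End DirectSum.

Definition giso (C C' : gcomplex) : Prop :=
  exists f : forall k, {additive C k -> C' k},
    [/\ forall k, bijective (f k),
        forall k x, f (k + 1) (gdiff C k x) = gdiff C' k (f k x)
      & forall k j x, ghomog j x <-> ghomog j (f k x)].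

Definition CKh (D : link_diagram) : gcomplex :=
  {| gob := fun k => chain D k;
     gdiff := fun k => @diff D k;
     ghomog := fun k j x => chain_homog j x |}.

Definition rCKh (D : link_diagram) (p : point D) (i : 'I_2) : gcomplex :=
  {| gob := fun k => rchain p i k;
     gdiff := fun k => @rdiff D p i k;
     ghomog := fun k j x => chain_homog j (rchain_val x) |}.

(* Main.v *)
(* In the basis of the labellings by 1 and X, the differential of CKh_alpha is
   symmetric in alpha1, alpha2. As R_alpha is free on 1, beta over its subring S
   of symmetric polynomials, CKh_alpha = C (+) beta C as complexes of S-modules,
   where C consists of the chains with coefficients in S. Take beta to be the
   root other than alpha_i. Multiplication by X_i at p is a chain map sending
   u + v X to (u + beta v) X_i at p, hence restricts to an isomorphism from C
   onto the reduced complex: every element of R_alpha is u + beta v for unique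
   u, v in S. *)
Require Import Defs.
From mathcomp Require Import all_boot all_order all_algebra.
From HB Require Import structures.
From mathcomp Require Import perm boolp ring.
From mathcomp.multinomials Require Import mpoly.

Set Implicit Arguments.
Unset Strict Implicit.
Unset Printing Implicit Defensive.

Import Order.TTheory GRing.Theory Num.Theory.
Local Open Scope ring_scope.

(** * The exchange of the two roots, and homogeneous polynomials *)

Definition flip : 'S_2 := tperm ord0 ord_max.

Local Notation swap := (@msym 2 int flip).

Lemma swapK : involutive swap.
Proof. by move=> r; rewrite -msymMm tperm2 msym1m. Qed.

Lemma swap_alpha i : swap (alpha i) = alpha (flip i).
Proof.
rewrite /alpha msymX; congr mpolyX; apply/mnmP => j.
by rewrite mnmE !mnm1E tpermV -(inj_eq (@perm_inj _ flip) i) tpermK.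
Qed.

Lemma flipK i : flip (flip i) = i.
Proof. exact: tpermK. Qed.

Lemma ord2P (i : 'I_2) : i = ord0 \/ i = ord_max.
Proof. by case: i => [[|[|//]] ?]; [left|right]; apply: val_inj. Qed.

Lemma eq_or_flip i j : j = i \/ j = flip i.
Proof.
by case: (ord2P i) (ord2P j) => -> [] ->; rewrite ?tpermL ?tpermR; auto.
Qed.

(** Makes [alpha (flip i) - alpha i] cancellable in the domain R_alpha, so that divided differences
    are unique. *)
Lemma alpha_flip_neq i : alpha (flip i) - alpha i != 0.
Proof.
have neq : alpha1 != alpha2.
  apply/eqP => /(congr1 (fun r : Ralpha => r@_U_(ord0))).
  by rewrite !mcoeffX !eqxx; case: eqP => // /mnmP /(_ ord0); rewrite !mnm1E.
rewrite subr_eq0; case: (ord2P i) => ->; rewrite ?tpermL ?tpermR //.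
by rewrite eq_sym.
Qed.

(* Degrees follow the quantum grading, in which each alpha has degree 2. *)
Definition qhomog (d : int) (r : Ralpha) : Prop :=
  forall m, m \in msupp r -> 2 * (mdeg m)%:Z = d.

Lemma qhomog0 d : qhomog d 0.
Proof. by move=> m; rewrite msupp0. Qed.

Lemma qhomogD d r r' : qhomog d r -> qhomog d r' -> qhomog d (r + r').
Proof.
by move=> hr hr' m /msuppD_le; rewrite mem_cat => /orP[/hr|/hr'].
Qed.

Lemma qhomogN d r : qhomog d r -> qhomog d (- r).
Proof. by move=> hr m; rewrite (perm_mem (msuppN r)) => /hr. Qed.

Lemma qhomogZ d (c : int) (r : Ralpha) : qhomog d r -> qhomog d (c *: r).
Proof. by move=> hr m /msuppZ_le/hr. Qed.

Lemma qhomogM d d' r r' :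
  qhomog d r -> qhomog d' r' -> qhomog (d + d') (r * r').
Proof.
move=> hr hr' m /msuppM_le/allpairsP[[m1 m2] /= [/hr <- /hr' <- ->]].
by rewrite mdegD PoszD mulrDr.
Qed.

Lemma qhomog_mpolyX (m : 'X_{1..2}) :
  qhomog (2 * (mdeg m)%:Z) ('X_[m] : Ralpha).
Proof. by move=> m'; rewrite msuppX inE => /eqP ->. Qed.

Lemma qhomog_alpha i : qhomog 2 (alpha i).
Proof. by have := @qhomog_mpolyX U_(i); rewrite mdeg1 mulr1. Qed.

(** * Divided differences *)

(** Induction on the degree, splitting off one variable by the twisted Leibniz rule [r r' - swap (r
    r') = (r - swap r) r' + swap r (r' - swap r')]. *)
Lemma swap_divisible_mpolyX i (m : 'X_{1..2}) :
  exists2 q : Ralpha,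
    'X_[m] - swap 'X_[m] = (alpha (flip i) - alpha i) * q &
    qhomog (2 * (mdeg m)%:Z - 2) q.
Proof.
have [k] := ubnP (mdeg m); elim: k m => // k IH m.
have [->|m0] := eqVneq m 0%MM.
  exists 0; last exact: qhomog0.
  by rewrite mpolyX0 msym1 subrr mulr0.
have [j mj] : exists j, m j != 0%N.
  apply: contrapT => h; case/eqP: m0; apply/mnmP => j; rewrite mnm0E.
  by apply/eqP; apply: contrapT => /negP mj; apply: h; exists j.
have mE : m = (U_(j) + (m - U_(j)))%MM.
  rewrite addmC submK //; apply/mnm_lepP => l; rewrite mnm1E.
  by case: eqP => // <-; rewrite lt0n.
move: (m - U_(j))%MM mE => m' ->.
rewrite mdegD mdeg1 add1n ltnS => /IH[q qE hq].
have [c cE] : exists c : int,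
    alpha j - alpha (flip j) = (alpha (flip i) - alpha i) * c%:MP.
  have [->|->] := eq_or_flip i j; last by exists 1; rewrite flipK mpolyC1 mulr1.
  by exists (-1); rewrite mpolyCN mpolyC1 mulrN1 opprB.
exists (c *: 'X_[m'] + alpha (flip j) * q).
  rewrite mpolyXD msymM -/(alpha j) swap_alpha.
  have qE' : swap 'X_[m'] = 'X_[m'] - (alpha (flip i) - alpha i) * q.
    by rewrite -qE; ring.
  rewrite qE' -mul_mpolyC.
  transitivity ((alpha j - alpha (flip j)) * 'X_[m']
    + alpha (flip j) * ((alpha (flip i) - alpha i) * q)); first ring.
  by rewrite cE; ring.
have -> : 2 * (mdeg m').+1%:Z - 2 = 2 * (mdeg m')%:Z by rewrite intS; ring.
apply: qhomogD.
  exact/qhomogZ/qhomog_mpolyX.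
have -> : 2 * (mdeg m')%:Z = 2 + (2 * (mdeg m')%:Z - 2) by ring.
exact/qhomogM/hq/qhomog_alpha.
Qed.

Lemma swap_divisible i r : exists q,
  r - swap r = (alpha (flip i) - alpha i) * q /\
  forall d, qhomog d r -> qhomog (d - 2) q.
Proof.
elim/mpolyind: r => [|c m r mr c0 [q [qE hq]]].
  exists 0; split=> [|d _]; last exact: qhomog0.
  by rewrite msym0 subr0 mulr0.
have [q' q'E hq'] := swap_divisible_mpolyX i m.
exists (c *: q' + q); split=> [|d hd].
  rewrite mulrDr -qE -scalerAr -q'E msymD msymZ scalerBr; ring.
apply: qhomogD.
  (* As [m] is outside the support of [r] and [c] is nonzero, [m] survives in the sum, which forces
     its degree. *)
  have <- : 2 * (mdeg m)%:Z = d.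
    apply: hd; rewrite mcoeff_msupp mcoeffD mcoeffZ mcoeffX eqxx.
    by rewrite (memN_msupp_eq0 mr) addr0 mulr1.
  exact: qhomogZ.
apply: hq => m' m'r; apply: hd.
have /negbTE mm' : m != m' by apply: contraNneq mr => ->.
by rewrite mcoeff_msupp mcoeffD mcoeffZ mcoeffX mm' mulr0 add0r -mcoeff_msupp.
Qed.

(** The divided difference (Demazure operator) of [r]. *)
Definition ddiff i r : Ralpha := sval (cid (swap_divisible i r)).

(** * R_alpha as a free module over the symmetric polynomials *)

Section Parts.
Variable i : 'I_2.
Local Notation beta := (alpha (flip i)).
Local Notation gamma := (alpha i).

Lemma ddiffE r : r - swap r = (beta - gamma) * ddiff i r.
Proof. by rewrite /ddiff; case: (cid _) => q []. Qed.

Lemma ddiff_uniq r q : r - swap r = (beta - gamma) * q -> ddiff i r = q.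
Proof. by rewrite ddiffE => /(mulfI (alpha_flip_neq i)). Qed.

Lemma qhomog_ddiff d r : qhomog d r -> qhomog (d - 2) (ddiff i r).
Proof. by rewrite /ddiff; case: (cid _) => q [_ /= hq] /hq. Qed.

(* The coordinates of r over the basis 1, beta of R_alpha as a module over the
   symmetric polynomials. *)
Definition part (e : bool) (r : Ralpha) : Ralpha :=
  if e then ddiff i r else r - beta * ddiff i r.

Lemma part_sum r : part false r + beta * part true r = r.
Proof. by rewrite subrK. Qed.

(** Numerator and denominator of the divided difference both change sign under [swap]. *)
Lemma swap_ddiff r : swap (ddiff i r) = ddiff i r.
Proof.
apply: esym; apply: ddiff_uniq; have /(congr1 swap) := ddiffE r.
rewrite msymB msymM msymB swapK !swap_alpha flipK => /(congr1 -%R).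
by rewrite opprB -mulNr opprB.
Qed.

Lemma swap_part e r : swap (part e r) = part e r.
Proof.
case: e => /=; first exact: swap_ddiff.
rewrite msymB msymM swap_alpha flipK swap_ddiff.
have -> : swap r = r - (beta - gamma) * ddiff i r by rewrite -ddiffE; ring.
ring.
Qed.

(** Uniqueness of the coordinates: [swap] replaces [beta] by [gamma], so the divided difference
    isolates [b]. *)
Lemma part_decomp a b e : swap a = a -> swap b = b ->
  part e (a + beta * b) = if e then b else a.
Proof.
move=> sa sb; have dE : ddiff i (a + beta * b) = b.
  by apply: ddiff_uniq; rewrite msymD msymM swap_alpha flipK sa sb; ring.
by rewrite /part dE; case: e => //; ring.
Qed.

Lemma partB e : {morph part e : r r' / r - r'}.
Proof.
move=> r r'; rewrite -{1}(part_sum r) -{1}(part_sum r').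
have -> : part false r + beta * part true r
    - (part false r' + beta * part true r') =
  (part false r - part false r') + beta * (part true r - part true r') by ring.
have sB e' : swap (part e' r - part e' r') = part e' r - part e' r'.
  by rewrite msymB !swap_part.
by rewrite part_decomp ?sB //; case: e.
Qed.

HB.instance Definition _ e :=
  GRing.isZmodMorphism.Build Ralpha Ralpha (part e) (partB e).

Lemma partM e c r : swap c = c -> part e (c * r) = c * part e r.
Proof.
move=> sc; rewrite -{1}(part_sum r) mulrDr mulrCA.
have sM e' : swap (c * part e' r) = c * part e' r.
  by rewrite msymM sc swap_part.
by rewrite part_decomp ?sM //; case: e.
Qed.

Lemma qhomog_part d (e : bool) r :
  qhomog d r -> qhomog (d - 2 * e%:Z) (part e r).
Proof.
case: e => hr /=; first exact: qhomog_ddiff.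
rewrite mulr0 subr0; apply/qhomogD/qhomogN => //.
have -> : d = 2 + (d - 2) by ring.
exact/qhomogM/qhomog_ddiff/hr/qhomog_alpha.
Qed.

(* Transposes the four symmetric coordinates of the pair (u, v); entry e of
   the transposed pair is [mix e u v]. *)
Definition mix (e : bool) (u v : Ralpha) : Ralpha := part e u + beta * part e v.

(** Transposing twice is the identity, so [mix] serves both in the splitting and in its inverse. *)
Lemma mixK e u v :
  mix e (mix false u v) (mix true u v) = if e then v else u.
Proof.
rewrite /mix !part_decomp ?swap_part //.
by case: e; rewrite part_sum.
Qed.

Lemma mixB e u v u' v' : mix e (u - u') (v - v') = mix e u v - mix e u' v'.
Proof. by rewrite /mix !raddfB /=; ring. Qed.

Lemma qhomog_mix d (e : bool) u v :
  qhomog d u -> qhomog (d - 2) v -> qhomog (d - 2 * e%:Z) (mix e u v).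
Proof.
move=> hu hv; apply: qhomogD; first exact: qhomog_part.
have -> : d - 2 * e%:Z = 2 + ((d - 2) - 2 * e%:Z) by ring.
exact/qhomogM/qhomog_part/hv/qhomog_alpha.
Qed.

End Parts.

(** * Two kinds of chain maps: symmetric coordinates and multiplication by X_i at p *)

Section Splitting.
Variables (D : link_diagram) (p : point D) (i : 'I_2).
Local Notation beta := (alpha (flip i)).
Local Notation gamma := (alpha i).

Lemma swap_sum_alpha : swap (alpha1 + alpha2) = alpha1 + alpha2.
Proof. by rewrite msymD !swap_alpha tpermL tpermR addrC. Qed.

Lemma swap_prod_alpha : swap (alpha1 * alpha2) = alpha1 * alpha2.
Proof. by rewrite msymM !swap_alpha tpermL tpermR mulrC. Qed.

(** In the basis 1, X the structure constants of m and Delta are 0, 1 and, up to sign, elementary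
    symmetric polynomials. *)
Lemma swap_edge_coef c (s t : state D) :
  swap (edge_coef c s t) = edge_coef c s t.
Proof.
rewrite /edge_coef; do 4?[case: ifP => _]; rewrite ?msym0 //.
  rewrite mul_coefE; do 2?[case: ifP => _].
  - exact: swap_sum_alpha.
  - by rewrite msymN swap_prod_alpha.
  - by rewrite rmorph_nat.
rewrite comul_coefE; do 3?[case: ifP => _];
  rewrite ?msym0 ?msym1 ?msymN ?swap_sum_alpha ?swap_prod_alpha //.
Qed.

Lemma swap_diff_coef (s t : state D) : swap (diff_coef s t) = diff_coef s t.
Proof.
rewrite /diff_coef raddf_sum; apply: eq_bigr => c _ /=.
by rewrite msymM swap_edge_coef /edge_sign rmorphXn /= msymN msym1.
Qed.

Definition map_part e k (x : chain D k) : chain D k :=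
  [ffun s => (part i e (x s) : Ralpha^o)].

(** The coordinates are linear over symmetric polynomials, in which the matrix of the differential
    has its entries. *)
Lemma diff_map_part e k (x : chain D k) :
  diff (map_part e x) = map_part e (diff x).
Proof.
apply/ffunP => t; rewrite !ffunE raddf_sum /=; apply: eq_bigr => s _.
by rewrite ffunE /GRing.scale /= partM ?swap_diff_coef.
Qed.

(* With the label of p made explicit, the matrix of the differential commutes
   with multiplication by X at p, i.e. with [[0, - beta gamma], [1, beta + gamma]]. *)
Lemma diff_coef_mulX s t :
  let E b b' := diff_coef (set_label p s b) (set_label p t b') in
  E false false = E true true - (beta + gamma) * E false true /\
  E true false = - (beta * gamma) * E false true.
Proof.
(* Stability of the reduced complexes of both roots gives two relations at target label 1; their
   difference is [beta - gamma] times the first claim. *)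
move=> E; have := diff_coef_reduced p i s t false.
have := diff_coef_reduced p (flip i) s t false.
rewrite /= -!/(E _ _) => Eb Eg.
have E11 : E false false = E true true - (beta + gamma) * E false true.
  apply: (mulfI (alpha_flip_neq i)).
  transitivity ((E true false - gamma * E false false)
    - (E true false - beta * E false false)); first ring.
  by rewrite Eb Eg; ring.
split=> //; move: Eg; rewrite E11 => /(canRL (subrK _)) ->; ring.
Qed.

(* Multiplication by X_i at p: u + v X goes to (u + beta v) X_i since
   X X_i = beta X_i. *)
Definition mulXi k (x : chain D k) : chain D k :=
  [ffun s => ((if lab (val s) p then 1 else - gamma) *
    ((x (gset_label p s false) : Ralpha) +
     beta * (x (gset_label p s true) : Ralpha))
    : Ralpha^o)].

Lemma gset_label_set k (s : gen D k) b b' :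
  gset_label p (gset_label p s b) b' = gset_label p s b'.
Proof. by apply: val_inj; rewrite /= set_label_set. Qed.

Lemma mulXi_proportional k (x : chain D k) : proportional p i (mulXi x).
Proof.
by move=> s; rewrite !ffunE lab_gset_label !gset_label_set mul1r.
Qed.

(** Pairs the source states that differ only at p, to bring out the 2 by 2 blocks of
    [diff_coef_mulX]. *)
Lemma diffE_labelled k (x : chain D k) t :
  diff x t = \sum_(s : gen D k | lab (val s) p)
    (diff_coef (set_label p (val s) true) (val t) *
       (x (gset_label p s true) : Ralpha) +
     diff_coef (set_label p (val s) false) (val t) *
       (x (gset_label p s false) : Ralpha)).
Proof.
rewrite ffunE (bigID (fun s : gen D k => lab (val s) p)) /=.
rewrite [X in _ + X](reindex_onto (fun s => gset_label p s false)
  (fun s => gset_label p s true)) /=; last first.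
  by move=> s /negbTE; exact: gset_labelK.
rewrite [X in _ + X](eq_bigl (fun s : gen D k => lab (val s) p)); last first.
  move=> s; rewrite lab_gset_label /=; apply/eqP/idP=> [<-|].
    by rewrite lab_gset_label.
  exact: gset_labelK.
rewrite -big_split /=; apply: eq_bigr => s ls.
have sE : gset_label p s true = s.
  by apply: val_inj; rewrite /= -ls set_label_id.
by have /= -> := congr1 val sE; rewrite sE.
Qed.

Lemma diff_mulXi k (x : chain D k) : diff (mulXi x) = mulXi (diff x).
Proof.
apply/ffunP => t.
(* Both sides are proportional to X_i at p, so comparing them at states labelled X there
   suffices. *)
rewrite (diff_proportional (mulXi_proportional x)).
rewrite (mulXi_proportional (diff x)).
congr (_ * _); rewrite [RHS]ffunE lab_gset_label !gset_label_set mul1r.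
rewrite !diffE_labelled mulr_sumr -big_split; apply: eq_bigr => s _ /=.
rewrite !ffunE !lab_gset_label !gset_label_set.
have [-> ->] := diff_coef_mulX (val s) (val t); ring.
Qed.

(** * The splitting and its inverse *)

Definition component e k (x : chain D k) : rchain p i k :=
  RChain (proportional_in_reduced (mulXi_proportional (map_part e x))).

Lemma componentE e k (x : chain D k) s :
  rchain_val (component e x) s =
  (if lab (val s) p then 1 else - gamma) *
  mix i e (x (gset_label p s false)) (x (gset_label p s true)).
Proof. by rewrite !ffunE. Qed.

Definition split_chain k (x : chain D k) : (rchain p i k * rchain p i k)%type :=
  (component false x, component true x).

Lemma componentB e k : {morph @component e k : x y / x - y}.
Proof.
move=> x y; apply: val_inj; rewrite raddfB /=; apply/ffunP => s.
rewrite [RHS]ffunE [X in _ = _ + X]ffunE !ffunE -mulrBr; congr (_ * _).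
by rewrite -mixB.
Qed.

Lemma split_chain_is_additive k : {morph @split_chain k : x y / x - y}.
Proof. by move=> x y; rewrite /split_chain !componentB. Qed.

HB.instance Definition _ k :=
  GRing.isZmodMorphism.Build (chain D k) (rchain p i k * rchain p i k)%type
    (@split_chain k) (@split_chain_is_additive k).

(** X_i has coefficient 1 at X, so a reduced chain is determined by its values at states labelled X
    at p; [mix] transposes these back. *)
Definition unsplit_chain k (y : rchain p i k * rchain p i k) : chain D k :=
  [ffun s => (mix i (lab (val s) p) (rchain_val y.1 (gset_label p s true))
     (rchain_val y.2 (gset_label p s true)) : Ralpha^o)].

Lemma split_chainK k : cancel (@split_chain k) (@unsplit_chain k).
Proof.
move=> x; apply/ffunP => s; rewrite ffunE /split_chain !componentE.
rewrite lab_gset_label !gset_label_set !mul1r mixK.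
by case: ifP => sp; congr (x _); apply: val_inj; rewrite /= -sp set_label_id.
Qed.

Lemma unsplit_chainK k : cancel (@unsplit_chain k) (@split_chain k).
Proof.
case=> y0 y1; congr pair; apply: val_inj; apply/ffunP => s;
  rewrite componentE !ffunE !lab_gset_label !gset_label_set mixK.
  by have /in_reduced_proportional -> := valP y0.
by have /in_reduced_proportional -> := valP y1.
Qed.

Lemma split_chain_diff k (x : chain D k) :
  split_chain (diff x) = (rdiff (split_chain x).1, rdiff (split_chain x).2).
Proof.
by congr pair; apply: val_inj; rewrite /= diff_mulXi diff_map_part.
Qed.

(** * Quantum degrees *)

Lemma qdeg_set_label (s : state D) (b : bool) :
  qdeg (set_label p s b) = qdeg (set_label p s false) + 2 * b%:Z.
Proof.
case: b; last by rewrite mulr0 addr0.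
have cX : #|[pred C | tagged (set_label p s true) C]| =
    #|[pred C | tagged (set_label p s false) C]|.+1.
  rewrite (cardD1 (circle_at (tag s) p)) !inE /= ffunE eqxx; congr _.+1.
  by apply: eq_card => C; rewrite !inE !ffunE; case: eqP.
by rewrite /qdeg cX intS /=; ring.
Qed.

Lemma qdeg_gset_label k (s : gen D k) :
  qdeg (val s) = qdeg (val (gset_label p s false)) + 2 * (lab (val s) p)%:Z.
Proof. by rewrite -qdeg_set_label set_label_id. Qed.

Lemma chain_homogP k j (x : chain D k) :
  chain_homog j x <-> forall s, qhomog (j - qdeg (val s)) (x s : Ralpha).
Proof.
split=> hx s m ms; first by rewrite -(hx s m ms) addrK.
by rewrite (hx s m ms) subrK.
Qed.

(** Multiplication by X_i raises the degree by 2; taking the coordinate at [beta] lowers it by 2. *)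
Lemma component_homog (e : bool) k j (x : chain D k) :
  chain_homog j x ->
  chain_homog (j + 2 - 2 * e%:Z) (rchain_val (component e x)).
Proof.
move=> /chain_homogP hx; apply/chain_homogP => s; rewrite componentE.
have hm : qhomog (j - qdeg (val (gset_label p s false)) - 2 * e%:Z)
    (mix i e (x (gset_label p s false)) (x (gset_label p s true))).
  apply: qhomog_mix; first exact: hx.
  have := hx (gset_label p s true).
  by rewrite /= qdeg_set_label mulr1 opprD addrA.
rewrite qdeg_gset_label; case: (lab _ _).
  rewrite mul1r mulr1; move: hm; congr qhomog; ring.
rewrite mulr0 addr0.
have -> : j + 2 - 2 * e%:Z - qdeg (val (gset_label p s false)) =
  2 + (j - qdeg (val (gset_label p s false)) - 2 * e%:Z) by ring.
exact/qhomogM/hm/qhomogN/qhomog_alpha.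
Qed.

Lemma unsplit_chain_homog k j (y : rchain p i k * rchain p i k) :
  chain_homog (j + 2) (rchain_val y.1) -> chain_homog j (rchain_val y.2) ->
  chain_homog j (unsplit_chain y).
Proof.
move=> /chain_homogP h0 /chain_homogP h1; apply/chain_homogP => s.
rewrite ffunE qdeg_gset_label opprD addrA.
have q1 : qdeg (val (gset_label p s true)) =
    qdeg (val (gset_label p s false)) + 2 by exact: qdeg_set_label.
apply: qhomog_mix.
  have := h0 (gset_label p s true); rewrite q1; congr qhomog; ring.
have := h1 (gset_label p s true); rewrite q1; congr qhomog; ring.
Qed.

End Splitting.

Theorem theorem2p18 (D : link_diagram) (p : point D) (i : 'I_2) :
  exists a b : int,
    giso (CKh D) (gsum (gshift a (rCKh p i)) (gshift b (rCKh p i))).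
Proof.
(* The component at 1 is raised in degree by 2, which the shift by -2 undoes; the component at
   [beta] keeps its degree. *)
exists (- 2), 0, (fun k => @split_chain D p i k); split=> [k|k x|k j x] /=.
- exists (@unsplit_chain D p i k); first exact: split_chainK.
  exact: unsplit_chainK.
- exact: split_chain_diff.
rewrite opprK subr0; split=> [hx|[h0 h1]].
  split.
    by have := @component_homog D p i false k j x hx; rewrite mulr0 subr0.
  by have := @component_homog D p i true k j x hx; rewrite mulr1 addrK.
rewrite -[x](split_chainK p i); exact: unsplit_chain_homog.
Qed.
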